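(* Let $\mathbb{F}$ be a field, $0\ne q\in\mathbb{F}$ not a root of unity, and $n\ge1$. Let $b$ be a maximal vector of weight $\lambda$ in some $U_q(\mathfrak{gl}_n)$-module $M$, where $\lambda$ is a partition with at most $n$ parts. Let $V_q$ be the vector representation of $U_q(\mathfrak{gl}_n)$ and $\Phi_1(b),\dots,\Phi_n(b)$ as defined in the context. Then: (a) $\Phi_1(b)=v_1\otimes b$ is a maximal vector of weight $\lambda+\varepsilon_1$ in $V_q\otimes M$. (b) For each $2\le m\le n$, if $\alpha_{m-1}^\vee(\lambda)=\lambda_{m-1}-\lambda_m\neq0$ then $\Phi_m(b)$ is a maximal vector of weight $\lambda+\varepsilon_m$ in $V_q\otimes M$.
   Context: Notation: $[m]=(q^m-q^{-m})/(q-q^{-1})$ for $m\in\mathbb{Z}$; $\varepsilon_i$ is the $i$th standard basis vector of $\mathbb{Z}^n$. **Algebra.** $U_q(\mathfrak{gl}_n)$ is the $\mathbb{F}$-algebra with generators $E_i,F_i$ ($1\le i\le n-1$), $K_i^{\pm1}$ ($1\le i\le n$) and relations: $K_iK_j=K_jK_i$, $K_iK_i^{-1}=1=K_i^{-1}K_i$; $E_iF_j-F_jE_i=\delta_{ij}\frac{\tilde K_i-\tilde K_i^{-1}}{q-q^{-1}}$ with $\tilde K_i=K_iK_{i+1}^{-1}$; $K_iE_j=q^{\delta_{i,j}-\delta_{i,j+1}}E_jK_i$, $K_iF_j=q^{-(\delta_{i,j}-\delta_{i,j+1})}F_jK_i$; $E_i^2E_j-(q+q^{-1})E_iE_jE_i+E_jE_i^2=0$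 if $|i-j|=1$, $E_iE_j=E_jE_i$ if $|i-j|>1$; and the same two relations with every $E$ replaced by $F$. Tensor products of modules are formed with the coproduct $\Delta(E_i)=E_i\otimes1+\tilde K_i\otimes E_i$, $\Delta(F_i)=F_i\otimes\tilde K_i^{-1}+1\otimes F_i$, $\Delta(K_i)=K_i\otimes K_i$. All modules are finite dimensional and are direct sums of weight spaces $M_\mu=\{v: K_iv=q^{\mu_i}v \text{ for all } i\}$, $\mu\in\mathbb{Z}^n$. The vector representation $V_q$ has basis $v_1,\dots,v_n$ with $K_jv_i=q^{\delta_{ij}}v_i$, $F_iv_i=v_{i+1}$, $E_iv_{i+1}=v_i$, and $F_i$, $E_i$ kill all other basis vectors. A maximal vector of weight $\lambda$ is a nonzero vector of weight $\lambda$ killed by all $E_i$. **The elements $\Psi_j$.** Fix a partition $\lambda$, extended by zeros, and put $\alpha_i^\vee(\lambda)=\lambda_i-\lambda_{i+1}$. Set $c_1=0$, $c_m=\lambda_2-\lambda_{m+1}+m-1$ ($m\ge2$), $d_m=\lambda_1-\lambda_{m+1}+m-1$ ($m\ge1$). Define $\Psi_0=1$, $\Psi_1=F_1/[d_1]$ and $\Psi_m=\frac1{[d_m]}\big([c_m]F_1\Psi_{m-1}^+-[c_m-1]\Psi_{m-1}^+F_1\big)$ for $m\ge2$. Here the superscript $+$ replaces each $F_i$ by $F_{i+1}$ and each $\alpha_i$ by $\alpha_{i+1}$ (i.e. each $\lambda_i$ by $\lambda_{i+1}$), and $+(k)$ means shifting $k$ times. **The operators $\Phi_m$.** $\Phi_1(b)=v_1\otimes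 b$ and, for $2\le m\le n$ with $\alpha_{m-1}^\vee(\lambda)\ne0$ (which guarantees that all denominators are nonzero), $\Phi_m(b)=\sum_{j=0}^{m-1}(-q^{-1})^j\,v_{m-j}\otimes\Psi_j^{+(m-j-1)}b\in V_q\otimes M$. *)

(* Defs.v *)
From HB Require Import structures.
From mathcomp Require Import all_boot all_order all_algebra.
From mathcomp Require Import ring.
Set Implicit Arguments.
Unset Strict Implicit.
Unset Printing Implicit Defensive.
Import Order.TTheory GRing.Theory Num.Theory.
Local Open Scope ring_scope.
Local Open Scope lfun_scope.

(* All indices start at 0: the rank parameter r stands for n - 1, so U_q(gl_n)
   has generators E_i, F_i (i : 'I_r) and K_i^{+-1} (i : 'I_r.+1).            *)

Definition qint (K : fieldType) (q : K) (m : int) : K :=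
  (q ^ m - q ^ (- m)) / (q - q^-1).

Definition not_root_of_unity (K : fieldType) (q : K) :=
  forall k : nat, (0 < k)%N -> q ^+ k != 1.

(* i and i + 1 as indices of the K's, for i the index of an E or F. *)
Definition lo (r : nat) (i : 'I_r) : 'I_r.+1 := widen_ord (leqnSn r) i.
Definition hi (r : nat) (i : 'I_r) : 'I_r.+1 := lift ord0 i.

(* delta_{a,j} - delta_{a,j+1} *)
Definition rootc (r : nat) (a : 'I_r.+1) (j : 'I_r) : int :=
  (a == lo j)%:Z - (a == hi j)%:Z.

(* |i - j| = 1 and |i - j| > 1 *)
Definition adjacent (i j : nat) := (i.+1 == j) || (j.+1 == i).
Definition distant (i j : nat) := (i.+1 < j)%N || (j.+1 < i)%N.

Section Relations.
Variables (K : fieldType) (q : K) (r : nat) (V : vectType K).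

Definition Kt (Kp Km : 'I_r.+1 -> 'End(V)) (i : 'I_r) : 'End(V) :=
  Kp (lo i) \o Km (hi i).

Definition Ktinv (Kp Km : 'I_r.+1 -> 'End(V)) (i : 'I_r) : 'End(V) :=
  Kp (hi i) \o Km (lo i).

Definition serre (X : 'I_r -> 'End(V)) :=
  (forall i j : 'I_r, adjacent i j ->
     (X i \o X i \o X j) - (q + q^-1) *: (X i \o X j \o X i)
       + (X j \o X i \o X i) = 0) /\
  (forall i j : 'I_r, distant i j -> X i \o X j = X j \o X i).

(* The defining relations of U_q(gl_{r+1}), imposed on operators on V;
   Km i is the image of K_i^{-1}. Note that \o has the precedence of + and -. *)
Record Uq_relations (E F : 'I_r -> 'End(V)) (Kp Km : 'I_r.+1 -> 'End(V)) :
    Prop := UqRelations {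
  rel_KK : forall i j, Kp i \o Kp j = Kp j \o Kp i;
  rel_KKm : forall i, Kp i \o Km i = \1;
  rel_KmK : forall i, Km i \o Kp i = \1;
  rel_EF : forall i j, (E i \o F j) - (F j \o E i) =
    (i == j)%:R *: ((q - q^-1)^-1 *: (Kt Kp Km i - Ktinv Kp Km i));
  rel_KE : forall a j, Kp a \o E j = q ^ rootc a j *: (E j \o Kp a);
  rel_KF : forall a j, Kp a \o F j = q ^ (- rootc a j) *: (F j \o Kp a);
  rel_serreE : serre E;
  rel_serreF : serre F
}.

End Relations.

(* A finite-dimensional U_q(gl_{r+1})-module: since the algebra is given by
   generators and relations, this is a finite-dimensional vector space with
   operators for the generators that satisfy the relations. *)
Record Uq_module (K : fieldType) (q : K) (r : nat) := UqModule {
  Uq_space :> vectType K;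
  actE : 'I_r -> 'End(Uq_space);
  actF : 'I_r -> 'End(Uq_space);
  actK : 'I_r.+1 -> 'End(Uq_space);
  actKinv : 'I_r.+1 -> 'End(Uq_space);
  Uq_moduleP : Uq_relations q actE actF actK actKinv
}.

Section Weights.
Variables (K : fieldType) (q : K) (r : nat) (M : Uq_module q r).

Definition wt_space (mu : 'rV[int]_r.+1) : {vspace M} :=
  (\bigcap_(i < r.+1) lker (actK M i - q ^ mu ord0 i *: \1))%VS.

Lemma wt_spaceP (mu : 'rV[int]_r.+1) (v : M) :
  reflect (forall i, actK M i v = q ^ mu ord0 i *: v) (v \in wt_space mu).
Proof.
rewrite /wt_space memvE; apply: (iffP subv_bigcapP) => h i.
  move/(_ i isT): h; rewrite -memvE memv_ker !lfun_simp /= subr_eq0.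
  by move/eqP.
by move=> _; rewrite -memvE memv_ker !lfun_simp /= subr_eq0 h.
Qed.

Definition weight_module : Prop :=
  (forall s : seq 'rV[int]_r.+1, uniq s ->
     directv (\sum_(mu <- s) wt_space mu)%VS) /\
  (exists s : seq 'rV[int]_r.+1,
     (\sum_(mu <- s) wt_space mu)%VS = fullv).

Definition maximal_vector (mu : 'rV[int]_r.+1) (v : M) : Prop :=
  [/\ v != 0, v \in wt_space mu & forall i, actE M i v = 0].

End Weights.

(* The tensor product of two finite-dimensional spaces, realized as the space
   of coordinate matrices; by tens_univ below it has the universal property. *)
Section Tensor.
Import passmx.
Variables (K : fieldType) (U V : vectType K).

Definition tensor : vectType K := 'M[K]_(\dim {:U}, \dim {:V}).

Definition tens (u : U) (v : V) : tensor :=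
  (rVof (vbasis {:U}) u)^T *m rVof (vbasis {:V}) v.

Lemma tensDl u1 u2 v : tens (u1 + u2) v = tens u1 v + tens u2 v.
Proof. by rewrite /tens !linearD /= mulmxDl. Qed.

Lemma tensDr u v1 v2 : tens u (v1 + v2) = tens u v1 + tens u v2.
Proof. by rewrite /tens !linearD /=. Qed.

Lemma tensZl c u v : tens (c *: u) v = c *: tens u v.
Proof. by rewrite /tens !linearZ /= -scalemxAl. Qed.

Lemma tensZr c u v : tens u (c *: v) = c *: tens u v.
Proof. by rewrite /tens !linearZ /=. Qed.

Lemma tensNl u v : tens (- u) v = - tens u v.
Proof. by rewrite -scaleN1r tensZl scaleN1r. Qed.

Lemma tensNr u v : tens u (- v) = - tens u v.
Proof. by rewrite -scaleN1r tensZr scaleN1r. Qed.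

Lemma tens0l v : tens 0 v = 0.
Proof. by rewrite -[X in tens X _](scale0r (0 : U)) tensZl scale0r. Qed.

Lemma tens0r u : tens u 0 = 0.
Proof. by rewrite -[X in tens _ X](scale0r (0 : V)) tensZr scale0r. Qed.

Lemma tens_delta (i : 'I_(\dim {:U})) (j : 'I_(\dim {:V})) :
  tens (vbasis {:U})`_i (vbasis {:V})`_j = delta_mx i j.
Proof.
rewrite /tens !rVofE ?vbasisP // trmx_delta.
by rewrite mul_delta_mx.
Qed.

Lemma tens_sum (t : tensor) :
  t = \sum_i \sum_j (t i j *: tens (vbasis {:U})`_i (vbasis {:V})`_j).
Proof.
rewrite [LHS]matrix_sum_delta; apply: eq_bigr => i _; apply: eq_bigr => j _.
by rewrite tens_delta.
Qed.

Lemma tens_lfunP (W : vectType K) (f g : 'Hom(tensor, W)) :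
  (forall u v, f (tens u v) = g (tens u v)) -> f = g.
Proof.
move=> fg; apply/lfunP => t; rewrite (tens_sum t) !linear_sum /=.
apply: eq_bigr => i _; rewrite !linear_sum /=; apply: eq_bigr => j _.
by rewrite !linearZ /= fg.
Qed.

Lemma tens_univ (W : vectType K) (B : U -> V -> W) :
  (forall v, linear (B^~ v)) -> (forall u, linear (B u)) ->
  exists! f : 'Hom(tensor, W), forall u v, f (tens u v) = B u v.
Proof.
move=> linl linr.
pose f0 (t : tensor) : W :=
  \sum_i \sum_j t i j *: B (vbasis {:U})`_i (vbasis {:V})`_j.
have f0_lin : linear f0.
  move=> c s t; rewrite /f0 scaler_sumr -big_split; apply: eq_bigr => i _ /=.
  rewrite scaler_sumr -big_split; apply: eq_bigr => j _ /=.
  by rewrite !mxE scalerDl scalerA.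
pose F0 := HB.pack_for {linear tensor -> W} f0 (GRing.isLinear.Build _ _ _ _ f0 f0_lin).
have fE u v : linfun F0 (tens u v) = B u v.
  rewrite lfunE /= /f0.
  pose Bl w := HB.pack_for {linear U -> W} (B^~ w)
    (GRing.isLinear.Build _ _ _ _ _ (linl w)).
  pose Br w := HB.pack_for {linear V -> W} (B w)
    (GRing.isLinear.Build _ _ _ _ _ (linr w)).
  rewrite [in RHS](coord_basis (vbasisP {:U}) (memvf u)).
  rewrite -[RHS]/(Bl v _) linear_sum; apply: eq_bigr => i _.
  rewrite linearZ /= -[X in _ = _ *: X]/(Br _ v).
  rewrite [in RHS](coord_basis (vbasisP {:V}) (memvf v)) linear_sum.
  rewrite scaler_sumr; apply: eq_bigr => j _; rewrite linearZ scalerA /=.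
  by rewrite !mxE big_ord_recl big_ord0 !mxE addr0.
exists (linfun F0); split=> // g gE.
by apply: tens_lfunP => u v; rewrite fE gE.
Qed.

(* f (x) g *)
Definition tens_lfun (f : 'End(U)) (g : 'End(V)) : 'End(tensor) :=
  linfun (fun t : tensor =>
    (mxof (vbasis {:U}) (vbasis {:U}) f)^T *m t
      *m mxof (vbasis {:V}) (vbasis {:V}) g).

Lemma tens_lfunE f g u v : tens_lfun f g (tens u v) = tens (f u) (g v).
Proof.
set A := (mxof (vbasis {:U}) (vbasis {:U}) f)^T.
set B := mxof (vbasis {:V}) (vbasis {:V}) g.
pose h (t : tensor) : tensor := A *m t *m B.
have h_lin : linear h.
  by move=> c s t; rewrite /h linearP /= mulmxDl -scalemxAl.
pose L := HB.pack_for {linear tensor -> tensor} h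
  (GRing.isLinear.Build _ _ _ _ h h_lin).
rewrite /tens_lfun -[linfun _]/(linfun L) lfunE /= /tens.
rewrite /h !(rVof_app (e := vbasis _) _ (vbasisP _)) trmx_mul !mulmxA.
by [].
Qed.

End Tensor.

Section TensorModule.
Variables (K : fieldType) (q : K) (r : nat).
Hypothesis q0 : q != 0.

Lemma rootc_lo (i : 'I_r) : rootc (lo i) i = 1.
Proof.
rewrite /rootc eqxx /=.
by have /negPf -> : lo i != hi i by rewrite -val_eqE /= /bump /= neq_ltn ltnSn.
Qed.

Lemma rootc_hi (i : 'I_r) : rootc (hi i) i = -1.
Proof.
rewrite /rootc eqxx /=.
by have /negPf -> : hi i != lo i
  by rewrite -val_eqE /= /bump /= neq_ltn ltnSn orbT.
Qed.

Definition cartan (i j : 'I_r) : int := rootc (lo i) j - rootc (hi i) j.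

Lemma cartanN (i j : 'I_r) : - cartan i j = rootc (hi i) j - rootc (lo i) j.
Proof. exact: opprB. Qed.

Lemma cartan_nat (i j : 'I_r) :
  cartan i j = ((i == j :> nat).*2)%:Z - (i == j.+1 :> nat)%:Z
                 - (i.+1 == j :> nat)%:Z.
Proof.
rewrite /cartan /rootc -!val_eqE /= /bump /= !add1n eqSS.
by case: (_ == _ :> nat); case: (_ == _ :> nat); case: (_ == _ :> nat).
Qed.

Lemma cartanC (i j : 'I_r) : cartan i j = cartan j i.
Proof.
rewrite !cartan_nat eq_sym (eq_sym (i : nat) j.+1) (eq_sym i.+1 (j : nat)).
by rewrite addrAC.
Qed.

Lemma cartan_ii (i : 'I_r) : cartan i i = 2.
Proof. by rewrite /cartan rootc_lo rootc_hi. Qed.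

Lemma cartan_adj (i j : 'I_r) : adjacent i j -> cartan i j = -1.
Proof.
rewrite cartan_nat /adjacent => /orP[] /eqP <-.
  by rewrite eqxx (ltn_eqF (ltnSn _)) ltn_eqF // ltnS leqnSn.
by rewrite eqxx (gtn_eqF (ltnSn _)) gtn_eqF // ltnS leqnSn.
Qed.

Lemma cartan_dist (i j : 'I_r) : distant i j -> cartan i j = 0.
Proof.
rewrite cartan_nat /distant => /orP[] h.
  have h' := ltn_trans (ltnSn i) h.
  by rewrite (ltn_eqF h) (ltn_eqF h') (ltn_eqF (leqW h')).
have h' := ltn_trans (ltnSn j) h.
by rewrite (gtn_eqF h) (gtn_eqF h') (gtn_eqF (leqW h')).
Qed.

Lemma distant_sym i j : distant i j -> distant j i.
Proof. by rewrite /distant orbC. Qed.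

Section Actions.
Variable M : Uq_module q r.
Let P := Uq_moduleP M.
Implicit Types x : M.

Lemma Kinv_of (Y : 'End(M)) a c :
  (forall x, actK M a (Y x) = q ^ c *: Y (actK M a x)) ->
  forall x, actKinv M a (Y x) = q ^ (- c) *: Y (actKinv M a x).
Proof.
move=> h x.
have KKm y : actK M a (actKinv M a y) = y.
  by rewrite -comp_lfunE (rel_KKm P) id_lfunE.
have KmK y : actKinv M a (actK M a y) = y.
  by rewrite -comp_lfunE (rel_KmK P) id_lfunE.
have := h (actKinv M a x); rewrite KKm => /(congr1 (actKinv M a)).
rewrite KmK linearZ /= => ->.
by rewrite scalerA -expfzDr // addNr expr0z scale1r.
Qed.

Lemma KE a j x : actK M a (actE M j x) = q ^ rootc a j *: actE M j (actK M a x).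
Proof. by rewrite -comp_lfunE (rel_KE P) !lfun_simp. Qed.

Lemma KF a j x :
  actK M a (actF M j x) = q ^ (- rootc a j) *: actF M j (actK M a x).
Proof. by rewrite -comp_lfunE (rel_KF P) !lfun_simp. Qed.

Lemma KmE a j x :
  actKinv M a (actE M j x) = q ^ (- rootc a j) *: actE M j (actKinv M a x).
Proof. by apply: Kinv_of => y; apply: KE. Qed.

Lemma KmF a j x :
  actKinv M a (actF M j x) = q ^ rootc a j *: actF M j (actKinv M a x).
Proof.
by rewrite -[rootc a j in RHS]opprK; apply: Kinv_of => y; apply: KF.
Qed.

Local Notation kt := (Kt (actK M) (actKinv M)).
Local Notation kti := (Ktinv (actK M) (actKinv M)).

Lemma KtE i j x : kt i (actE M j x) = q ^ cartan i j *: actE M j (kt i x).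
Proof.
by rewrite !comp_lfunE KmE linearZ /= KE scalerA -expfzDr // addrC.
Qed.

Lemma KtF i j x : kt i (actF M j x) = q ^ (- cartan i j) *: actF M j (kt i x).
Proof.
by rewrite !comp_lfunE KmF linearZ /= KF scalerA -expfzDr // cartanN.
Qed.

Lemma KtiE i j x :
  kti i (actE M j x) = q ^ (- cartan i j) *: actE M j (kti i x).
Proof.
by rewrite !comp_lfunE KmE linearZ /= KE scalerA -expfzDr // cartanN addrC.
Qed.

Lemma KtiF i j x : kti i (actF M j x) = q ^ cartan i j *: actF M j (kti i x).
Proof.
by rewrite !comp_lfunE KmF linearZ /= KF scalerA -expfzDr.
Qed.

Lemma KmKC i j x : actKinv M i (actK M j x) = actK M j (actKinv M i x).
Proof.
have := @Kinv_of (actK M j) i 0 _ x; rewrite oppr0 expr0z scale1r; apply=> y.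
by rewrite scale1r -!comp_lfunE (rel_KK P).
Qed.

Lemma KmKmC i j x : actKinv M i (actKinv M j x) = actKinv M j (actKinv M i x).
Proof.
have := @Kinv_of (actKinv M j) i 0 _ x; rewrite oppr0 expr0z scale1r; apply=> y.
by rewrite scale1r KmKC.
Qed.

Lemma KKC i j x : actK M i (actK M j x) = actK M j (actK M i x).
Proof. by rewrite -!comp_lfunE (rel_KK P). Qed.

Lemma KtK i a x : kt i (actK M a x) = actK M a (kt i x).
Proof. by rewrite !comp_lfunE KmKC KKC. Qed.

Lemma KtiK i a x : kti i (actK M a x) = actK M a (kti i x).
Proof. by rewrite !comp_lfunE KmKC KKC. Qed.

Lemma KtKt i j x : kt i (kt j x) = kt j (kt i x).
Proof. by rewrite !comp_lfunE !KmKC KKC KmKmC. Qed.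

Lemma KtiKti i j x : kti i (kti j x) = kti j (kti i x).
Proof. by rewrite !comp_lfunE !KmKC KKC KmKmC. Qed.

Lemma EFc i j x : actE M i (actF M j x) = actF M j (actE M i x) +
  (i == j)%:R *: ((q - q^-1)^-1 *: (kt i x - kti i x)).
Proof.
have := rel_EF P i j; move: (kt i) (kti i) => k k' /lfunP/(_ x).
rewrite !lfun_simp /= => /eqP.
by rewrite subr_eq addrC => /eqP.
Qed.

Lemma serre_fun (X : 'I_r -> 'End(M)) (i j : 'I_r) x : serre q X -> adjacent i j ->
  X i (X i (X j x)) = (q + q^-1) *: X i (X j (X i x)) - X j (X i (X i x)).
Proof.
case=> h _ /h /lfunP/(_ x); rewrite !lfun_simp /= => /eqP.
by rewrite addr_eq0 subr_eq => /eqP ->; rewrite addrC.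
Qed.

Lemma far_fun (X : 'I_r -> 'End(M)) (i j : 'I_r) x : serre q X -> distant i j ->
  X i (X j x) = X j (X i x).
Proof. by case=> _ h /h /lfunP/(_ x); rewrite !comp_lfunE. Qed.

End Actions.

Definition ent (U V : vectType K) (t : tensor U V)
  (i : 'I_(\dim {:U})) (j : 'I_(\dim {:V})) : K := t i j.
Local Lemma qm1 : q ^ (-1) = (q^-1)%R. Proof. by []. Qed.
Local Lemma q2 : q ^ 2 = q * q. Proof. by []. Qed.
Local Lemma EF_fun (V : vectType K) (e f k k' : 'End(V)) c d x :
  e (f x) - f (e x) = c *: (d *: (k x - k' x)) ->
  ((e \o f) - (f \o e)) x = (c *: (d *: (k - k'))) x.
Proof. by rewrite !lfun_simp. Qed.
Local Lemma lfD (U V : vectType K) (f : 'Hom(U, V)) x y : f (x + y) = f x + f y.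
Proof. exact: linearD. Qed.
Local Lemma lfZ (U V : vectType K) (f : 'Hom(U, V)) c x : f (c *: x) = c *: f x.
Proof. exact: linearZ. Qed.
Lemma tens_ext (U V : vectType K) (s t : tensor U V) : ent s =2 ent t -> s = t.
Proof. by move=> h; apply/matrixP. Qed.
Lemma entD (U V : vectType K) (s t : tensor U V) i j :
  ent (s + t) i j = ent s i j + ent t i j.
Proof. exact: mxE. Qed.
Lemma entN (U V : vectType K) (s : tensor U V) i j : ent (- s) i j = - ent s i j.
Proof. exact: mxE. Qed.
Lemma entZ (U V : vectType K) c (s : tensor U V) i j :
  ent (c *: s) i j = c * ent s i j.
Proof. exact: mxE. Qed.
Lemma ent0 (U V : vectType K) i j : ent (0 : tensor U V) i j = 0.
Proof. exact: mxE. Qed.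
Definition entE := (entD, entN, entZ, ent0).
Definition tensE := (tensDl, tensDr, tensNl, tensNr, tensZl, tensZr).

Variables M N : Uq_module q r.
Local Notation ktM := (Kt (actK M) (actKinv M)).
Local Notation ktiN := (Ktinv (actK N) (actKinv N)).

(* Delta(E_i), Delta(F_i), Delta(K_i), Delta(K_i^{-1}) acting on M (x) N *)
Definition tensorE (i : 'I_r) : 'End(tensor M N) :=
  tens_lfun (actE M i) \1 + tens_lfun (ktM i) (actE N i).
Definition tensorF (i : 'I_r) : 'End(tensor M N) :=
  tens_lfun (actF M i) (ktiN i) + tens_lfun \1 (actF N i).
Definition tensorK (i : 'I_r.+1) : 'End(tensor M N) :=
  tens_lfun (actK M i) (actK N i).
Definition tensorKinv (i : 'I_r.+1) : 'End(tensor M N) :=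
  tens_lfun (actKinv M i) (actKinv N i).

Lemma tensorEE i u v :
  tensorE i (tens u v) = tens (actE M i u) v + tens (ktM i u) (actE N i v).
Proof. by rewrite add_lfunE !tens_lfunE id_lfunE. Qed.

Lemma tensorFE i u v :
  tensorF i (tens u v) = tens (actF M i u) (ktiN i v) + tens u (actF N i v).
Proof. by rewrite add_lfunE !tens_lfunE id_lfunE. Qed.

Lemma tensorKE i u v :
  tensorK i (tens u v) = tens (actK M i u) (actK N i v).
Proof. exact: tens_lfunE. Qed.

Lemma tensorKinvE i u v :
  tensorKinv i (tens u v) = tens (actKinv M i u) (actKinv N i v).
Proof. exact: tens_lfunE. Qed.

Lemma serre_tens (X : 'I_r -> 'End(tensor M N)) :
  (forall (i j : 'I_r) u v, adjacent i j ->
     X i (X i (X j (tens u v))) - (q + q^-1) *: X i (X j (X i (tens u v)))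
       + X j (X i (X i (tens u v))) = 0) ->
  (forall (i j : 'I_r) u v, distant i j ->
     X i (X j (tens u v)) = X j (X i (tens u v))) ->
  serre q X.
Proof.
move=> h1 h2; split=> i j ij; apply: tens_lfunP => u v.
  by rewrite !lfun_simp /= h1.
by rewrite !comp_lfunE h2.
Qed.

Lemma tensor_serreE : serre q tensorE.
Proof.
apply: serre_tens => i j u v ij; last first.
  rewrite !(tensorEE, lfD).
  rewrite !(KtE, cartan_dist ij, cartan_dist (distant_sym ij)).
  rewrite !expr0z !scale1r (KtKt i j).
  rewrite (far_fun _ (rel_serreE (Uq_moduleP M)) ij).
  rewrite (far_fun _ (rel_serreE (Uq_moduleP N)) ij).
  by apply: tens_ext => s t; rewrite !entE; ring.
rewrite !(tensorEE, lfD).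
have ji : adjacent j i by rewrite /adjacent orbC.
rewrite !(KtE, cartan_adj ij, cartan_adj ji, cartan_ii, lfZ).
rewrite !(KtKt j i).
rewrite (serre_fun _ (rel_serreE (Uq_moduleP M)) ij).
rewrite (serre_fun _ (rel_serreE (Uq_moduleP N)) ij).
by apply: tens_ext => s t; rewrite !tensE !entE qm1 q2; field.
Qed.

Lemma tensor_serreF : serre q tensorF.
Proof.
apply: serre_tens => i j u v ij; last first.
  rewrite !(tensorFE, lfD).
  rewrite !(KtiF, cartan_dist ij, cartan_dist (distant_sym ij)).
  rewrite !expr0z !scale1r (KtiKti i j).
  rewrite (far_fun _ (rel_serreF (Uq_moduleP M)) ij).
  rewrite (far_fun _ (rel_serreF (Uq_moduleP N)) ij).
  by apply: tens_ext => s t; rewrite !entE; ring.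
rewrite !(tensorFE, lfD).
have ji : adjacent j i by rewrite /adjacent orbC.
rewrite !(KtiF, cartan_adj ij, cartan_adj ji, cartan_ii, lfZ).
rewrite !(KtiKti j i).
rewrite (serre_fun _ (rel_serreF (Uq_moduleP M)) ij).
rewrite (serre_fun _ (rel_serreF (Uq_moduleP N)) ij).
by apply: tens_ext => s t; rewrite !tensE !entE qm1 q2; field.
Qed.

Lemma tensor_Kt i u v : Kt tensorK tensorKinv i (tens u v) =
  tens (ktM i u) (Kt (actK N) (actKinv N) i v).
Proof. by rewrite /Kt comp_lfunE tensorKinvE tensorKE -!comp_lfunE. Qed.

Lemma tensor_Ktinv i u v : Ktinv tensorK tensorKinv i (tens u v) =
  tens (Ktinv (actK M) (actKinv M) i u) (ktiN i v).
Proof. by rewrite /Ktinv comp_lfunE tensorKinvE tensorKE -!comp_lfunE. Qed.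

Lemma tensor_EF i j u v :
  tensorE i (tensorF j (tens u v)) - tensorF j (tensorE i (tens u v)) =
  (i == j)%:R *: ((q - q^-1)^-1 *: (Kt tensorK tensorKinv i (tens u v)
                                    - Ktinv tensorK tensorKinv i (tens u v))).
Proof.
rewrite [in RHS]tensor_Kt.
rewrite [in RHS]tensor_Ktinv.
rewrite (tensorEE i u v) (tensorFE j u v) !lfD.
rewrite (tensorEE i (actF M j u)) (tensorEE i u).
rewrite (tensorFE j (actE M i u)) (tensorFE j (ktM i u)).
rewrite !KtF.
rewrite !KtiE.
rewrite !EFc.
rewrite (cartanC j i).
apply: tens_ext => s t; rewrite !tensE !entE.
by case: eqVneq => [<-|_]; rewrite ?mul0r ?scale0r ?mul1r; ring.
Qed.

Lemma tensor_relations : Uq_relations q tensorE tensorF tensorK tensorKinv.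
Proof.
split; first 6 last.
- exact: tensor_serreE.
- exact: tensor_serreF.
- move=> i j; apply: tens_lfunP => u v; rewrite !comp_lfunE !tensorKE.
  by rewrite KKC (KKC (M := N)).
- move=> i; apply: tens_lfunP => u v.
  rewrite comp_lfunE tensorKinvE tensorKE -!comp_lfunE.
  by rewrite !(rel_KKm (Uq_moduleP _)) !id_lfunE.
- move=> i; apply: tens_lfunP => u v.
  rewrite comp_lfunE tensorKE tensorKinvE -!comp_lfunE.
  by rewrite !(rel_KmK (Uq_moduleP _)) !id_lfunE.
- move=> i j; apply: tens_lfunP => u v; 
  exact/EF_fun/tensor_EF.
- move=> a j; apply: tens_lfunP => u v.
  rewrite scale_lfunE !comp_lfunE !(tensorEE, tensorKE, lfD) KtK.
  by rewrite !KE !tensZl !tensZr scalerDr.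
- move=> a j; apply: tens_lfunP => u v.
  rewrite scale_lfunE !comp_lfunE !(tensorFE, tensorKE, lfD) KtiK.
  by rewrite !KF !tensZl !tensZr scalerDr.
Qed.

Definition tensor_module : Uq_module q r := UqModule tensor_relations.

End TensorModule.

Section VectorRepresentation.
Variables (K : fieldType) (q : K) (r : nat).
Hypothesis q0 : q != 0.
Local Notation V := 'rV[K]_r.+1.

Definition vq (i : 'I_r.+1) : V := delta_mx 0 i.

(* Operators on row vectors are given by right multiplication; see vecEE,
   vecFE and vecKE for the action on the basis vectors. *)
Definition vecE (i : 'I_r) : 'End(V) := linfun (mulmxr (delta_mx (hi i) (lo i))).
Definition vecF (i : 'I_r) : 'End(V) := linfun (mulmxr (delta_mx (lo i) (hi i))).
Definition vecK (j : 'I_r.+1) : 'End(V) :=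
  linfun (mulmxr (diag_mx (\row_i q ^ (i == j)%:Z))).
Definition vecKinv (j : 'I_r.+1) : 'End(V) :=
  linfun (mulmxr (diag_mx (\row_i q ^ (- (i == j)%:Z)))).

Lemma vecEE i a : vecE i (vq a) = (a == hi i)%:R *: vq (lo i).
Proof. by rewrite lfunE /= mul_delta_mx_cond scaler_nat. Qed.

Lemma vecFE i a : vecF i (vq a) = (a == lo i)%:R *: vq (hi i).
Proof. by rewrite lfunE /= mul_delta_mx_cond scaler_nat. Qed.

Lemma vq_diag (d : V) a : vq a *m diag_mx d = d 0 a *: vq a.
Proof.
rewrite -rowE; apply/rowP => k; rewrite !mxE eqxx /=.
by rewrite mulr_natr eq_sym.
Qed.

Lemma vecKE j a : vecK j (vq a) = q ^ (a == j)%:Z *: vq a.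
Proof. by rewrite lfunE /= vq_diag mxE. Qed.

Lemma vecKinvE j a : vecKinv j (vq a) = q ^ (- (a == j)%:Z) *: vq a.
Proof. by rewrite lfunE /= vq_diag mxE. Qed.

Lemma vec_lfunP (f g : 'End(V)) : (forall a, f (vq a) = g (vq a)) -> f = g.
Proof.
move=> fg; apply/lfunP => x; rewrite (row_sum_delta x) !linear_sum /=.
by apply: eq_bigr => a _; rewrite !linearZ /= fg.
Qed.

Lemma lo_eq (i j : 'I_r) : (lo i == lo j) = (i == j).
Proof. by []. Qed.

Lemma hi_eq (i j : 'I_r) : (hi i == hi j) = (i == j).
Proof. by rewrite -!val_eqE /= /bump /= !add1n eqSS. Qed.

Lemma lo_hi (i j : 'I_r) : (lo i == hi j) = (i == j.+1 :> nat).
Proof. by []. Qed.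

Lemma hi_lo (i j : 'I_r) : (hi i == lo j) = (i.+1 == j :> nat).
Proof. by []. Qed.

Local Lemma serre_apply (e f : 'End(V)) c x :
  e (e (f x)) - c *: e (f (e x)) + f (e (e x)) = 0 ->
  ((e \o e \o f) - c *: (e \o f \o e) + (f \o e \o e)) x = (0 : 'End(V)) x.
Proof. by rewrite !lfun_simp. Qed.

Lemma vec_serreE : serre q vecE.
Proof.
split=> i j; rewrite /adjacent /distant => ij; apply: vec_lfunP => a.
  apply: serre_apply; rewrite !(vecEE, lfZ) !scalerA !lo_hi.
  rewrite [i == i.+1 :> nat]ltn_eqF // !(mul0r, mulr0) scale0r.
  have [e|_] := boolP (i == j.+1 :> nat); last first.
    by rewrite !(mul0r, mulr0, scale0r) subr0 addr0.
  have -> : (j == i.+1 :> nat) = false by rewrite (eqP e) ltn_eqF // ltnS leqnSn.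
  by rewrite !(mul0r, mulr0, scale0r) subr0 addr0.
rewrite !comp_lfunE !(vecEE, lfZ) !scalerA !lo_hi.
have -> : (i == j.+1 :> nat) = false.
  by case/orP: ij => h; [rewrite ltn_eqF // ltnS ltnW // ltnW | rewrite gtn_eqF].
have -> : (j == i.+1 :> nat) = false.
  by case/orP: ij => h; [rewrite gtn_eqF | rewrite ltn_eqF // ltnS ltnW // ltnW].
by rewrite !mulr0 !scale0r.
Qed.

Lemma vec_serreF : serre q vecF.
Proof.
split=> i j; rewrite /adjacent /distant => ij; apply: vec_lfunP => a.
  apply: serre_apply; rewrite !(vecFE, lfZ) !scalerA !hi_lo.
  rewrite [i.+1 == i :> nat]gtn_eqF // !(mul0r, mulr0) scale0r.
  have [e|_] := boolP (i.+1 == j :> nat); last first.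
    by rewrite !(mul0r, mulr0, scale0r) subr0 addr0.
  have -> : (j.+1 == i :> nat) = false by rewrite -(eqP e) gtn_eqF // ltnS leqnSn.
  by rewrite !(mul0r, mulr0, scale0r) subr0 addr0.
rewrite !comp_lfunE !(vecFE, lfZ) !scalerA !hi_lo.
have -> : (i.+1 == j :> nat) = false.
  by case/orP: ij => h; [rewrite ltn_eqF | rewrite gtn_eqF // ltnS ltnW // ltnW].
have -> : (j.+1 == i :> nat) = false.
  by case/orP: ij => h; [rewrite gtn_eqF // ltnS ltnW // ltnW | rewrite ltn_eqF].
by rewrite !mulr0 !scale0r.
Qed.

Lemma vec_relations (qq : q - q^-1 != 0) :
  Uq_relations q vecE vecF vecK vecKinv.
Proof.
split; first 6 last.
- exact: vec_serreE.
- exact: vec_serreF.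
- move=> i j; apply: vec_lfunP => a.
  by rewrite !comp_lfunE !(vecKE, lfZ) !scalerA mulrC.
- move=> i; apply: vec_lfunP => a.
  rewrite comp_lfunE id_lfunE vecKinvE lfZ vecKE scalerA -expfzDr //.
  by rewrite addNr expr0z scale1r.
- move=> i; apply: vec_lfunP => a.
  rewrite comp_lfunE id_lfunE vecKE lfZ vecKinvE scalerA -expfzDr //.
  by rewrite subrr expr0z scale1r.
- move=> i j; apply: vec_lfunP => a.
  apply: EF_fun; rewrite !comp_lfunE.
  rewrite vecFE vecEE !lfZ vecEE vecFE !vecKinvE !lfZ !vecKE !scalerA.
  rewrite hi_eq lo_eq (eq_sym j i).
  case: (eqVneq i j) => [<-|_]; last by rewrite !(mulr0, mul0r, scale0r) subrr.
  have lohi : lo i == hi i = false by rewrite lo_hi ltn_eqF.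
  rewrite !mulr1 !mul1r -!expfzDr //.
  have [->|na] := eqVneq a (lo i).
    rewrite lohi !(mulr0n, scale0r, subr0, mulr1n, oppr0, add0r, addr0, scale1r).
    by rewrite -scalerBl scalerA mulVf // scale1r.
  have [->|nb] := eqVneq a (hi i).
    rewrite !(mulr0n, scale0r, sub0r, mulr1n, oppr0, add0r, addr0, scale1r).
    rewrite -scalerBl scalerA -[X in _ = (_ * X) *: _]opprB mulrN mulVf //.
    by rewrite scaleN1r.
  by rewrite !scale0r !subrr scaler0.
- move=> b j; apply: vec_lfunP => a.
  rewrite scale_lfunE !comp_lfunE !(vecEE, vecKE, lfZ) !scalerA.
  have [->|_] := eqVneq a (hi j); last by rewrite !(mulr0, mul0r, scale0r).
  rewrite !mulr1 mul1r -expfzDr // /rootc (eq_sym b) (eq_sym b).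
  by rewrite subrK.
- move=> b j; apply: vec_lfunP => a.
  rewrite scale_lfunE !comp_lfunE !(vecFE, vecKE, lfZ) !scalerA.
  have [->|_] := eqVneq a (lo j); last by rewrite !(mulr0, mul0r, scale0r).
  rewrite !mulr1 mul1r -expfzDr // /rootc opprB (eq_sym b) (eq_sym b).
  by rewrite subrK.
Qed.

End VectorRepresentation.

Lemma subqV_neq0 (K : fieldType) (q : K) :
  q != 0 -> not_root_of_unity q -> q - q^-1 != 0.
Proof.
move=> q0 /(_ 2%N isT); apply: contraNneq => /eqP; rewrite subr_eq0 => /eqP h.
by rewrite expr2 [X in _ * X]h mulfV.
Qed.

Definition vector_module (K : fieldType) (q : K) (r : nat) (q0 : q != 0)
    (qru : not_root_of_unity q) : Uq_module q r :=
  UqModule (vec_relations r q0 (subqV_neq0 q0 qru)).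

(* The k-fold shift +(k), on partitions and on the family of the F_i. *)
Definition shift (T : Type) (k : nat) (f : nat -> T) : nat -> T :=
  fun i => f (k + i)%N.

Section Psi.
Variables (K : fieldType) (q : K).

(* c_m and d_m; lam 0 is the first part of the partition. *)
Definition cnum (lam : nat -> nat) (m : nat) : int :=
  if m is m'.+2 then (lam 1%N)%:Z - (lam m)%:Z + m%:Z - 1 else 0.
Definition dnum (lam : nat -> nat) (m : nat) : int :=
  (lam 0%N)%:Z - (lam m)%:Z + m%:Z - 1.

(* The operator by which Psi_m acts, in terms of the operators f by which the
   F_i act; Psi_m^{+(k)} is Psi (shift k lam) (shift k f) m. *)
Fixpoint Psi (V : vectType K) (lam : nat -> nat) (f : nat -> 'End(V))
    (m : nat) : 'End(V) :=
  match m with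
  | 0 => \1
  | m'.+1 =>
    if m' is 0 then (qint q (dnum lam 1))^-1 *: f 0%N else
    let P := Psi (shift 1 lam) (shift 1 f) m' in
    (qint q (dnum lam m))^-1 *:
      (qint q (cnum lam m) *: (f 0%N \o P)
       - qint q (cnum lam m - 1) *: (P \o f 0%N))
  end.

End Psi.

(* The action of F_i with i ranging over nat (zero beyond the index range). *)
Definition actFn (K : fieldType) (q : K) (r : nat) (M : Uq_module q r)
    (i : nat) : 'End(M) :=
  if insub i is Some j then actF M j else 0.

Section Phi.
Variables (K : fieldType) (q : K) (r : nat).
Variables (q0 : q != 0) (qru : not_root_of_unity q).
Variable M : Uq_module q r.

Definition Vq_tensor : Uq_module q r :=
  tensor_module q0 (vector_module r q0 qru) M.

Definition vtens (i : 'I_r.+1) (x : M) : Vq_tensor :=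
  tens (vq K i : vector_module r q0 qru) x.

(* Indices start at 0, so Phi m here is the operator numbered m + 1 when they
   start at 1; its terms only involve F_i with i < m <= r. *)
Definition Phi (lam : nat -> nat) (b : M) (m : 'I_r.+1) : Vq_tensor :=
  if m == ord0 then vtens ord0 b else
  \sum_(j < m.+1) (- q^-1) ^+ j *:
    vtens (inord (m - j)) (Psi q (shift (m - j) lam) (shift (m - j) (actFn M)) j b).

End Phi.

(* The partition lam (a weakly decreasing sequence), extended by zeros, and
   the corresponding weight. *)
Definition part (lam : seq nat) : nat -> nat := nth 0%N lam.
Definition part_weight (r : nat) (lam : seq nat) : 'rV[int]_r.+1 :=
  \row_i (part lam i)%:Z.

(* Main.v *)
(* Since Delta(E_i) = E_i (x) 1 + Kt_i (x) E_i, comparing coefficients of the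
   v_a shows that Phi_m(b) is killed by all E_i as soon as
   E_i Psi_j^{+(k)} b = delta_{ik} Psi_{j-1}^{+(k+1)} b for j >= 1.
   The recursion for Psi_j involves both F_1 Psi^+ b and Psi^+ F_1 b, and F_1 b
   is maximal for the shifted algebra, but its weight is off by one in its
   first coordinate. So one proves by induction, for y of weight lambda except
   for an excess t in the first coordinate, that
   E_i Psi_j y = delta_{i1} ([d_j + t] / [d_j]) Psi_{j-1}^+ y, using
   [c][a + 1] - [c - 1][a] = [a + c] when i = 1, and d_{j-1}^+ + 1 = c_j to
   cancel the two terms when i = 2. *)
Require Import Defs.
From mathcomp Require Import all_boot all_order all_algebra.
From mathcomp Require Import ring zify.
Set Implicit Arguments.
Unset Strict Implicit.
Unset Printing Implicit Defensive.
Import GRing.Theory.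
Local Open Scope ring_scope.

(** * Quantum integers for [q] not a root of unity *)

Section QuantumIntegers.
Variables (K : fieldType) (q : K).
Hypotheses (q0 : q != 0) (qru : not_root_of_unity q).

(** Multiplying q^m = q^(-m) by q^m would give q^(2m) = 1; for negative m, invert. *)
Lemma qint_neq0 (m : int) : m != 0 -> qint q m != 0.
Proof.
move=> m0; apply: mulf_neq0; last by rewrite invr_neq0 ?subqV_neq0.
rewrite subr_eq0; apply/eqP => /(congr1 ( *%R (q ^ m))).
rewrite -!expfzDr // subrr expr0z => /eqP; apply/negP.
case: m m0 => k k0; first by apply: qru; lia.
rewrite NegzE -opprD -PoszD -invr_expz invr_eq1.
by apply: qru; lia.
Qed.

(** A rational identity in q^a, q^c and q; it merges the two terms of the [Psi] recursion. *)
Lemma qint_bilinear (a c : int) :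
  qint q c * qint q (a + 1) - qint q (c - 1) * qint q a = qint q (a + c).
Proof.
have qq := subqV_neq0 q0 qru.
rewrite /qint !opprD !expfzDr // opprK -!invr_expz.
rewrite !expr1z.
have A0 : q ^ a != 0 by rewrite expfz_neq0.
have C0 : q ^ c != 0 by rewrite expfz_neq0.
have Q0 : q * q - 1 != 0.
  by rewrite -[1](mulfV q0) -mulrBr mulf_neq0.
by field; apply/and4P.
Qed.

End QuantumIntegers.

#[local] Arguments Psi : simpl never.
#[local] Arguments cnum : simpl never.

(** * Formal properties of [Psi] for arbitrary operators *)

Section PsiGeneral.
Variables (K : fieldType) (q : K) (V : vectType K).

Lemma lfun_lincomb (X : 'End(V)) c d x y :
  X (c *: x - d *: y) = c *: X x - d *: X y.
Proof. by rewrite linearB /= ![X (_ *: _)]linearZ. Qed.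

Lemma Psi1 (lam : nat -> nat) (f : nat -> 'End(V)) :
  Psi q lam f 1 = (qint q (dnum lam 1))^-1 *: f 0.
Proof. by []. Qed.

Lemma PsiSS (lam : nat -> nat) (f : nat -> 'End(V)) m :
  let P := Psi q (shift 1 lam) (shift 1 f) m.+1 in
  Psi q lam f m.+2 = (qint q (dnum lam m.+2))^-1 *:
    (qint q (cnum lam m.+2) *: (f 0 \o P)
     - qint q (cnum lam m.+2 - 1) *: (P \o f 0))%VF.
Proof. by []. Qed.

(** Needed because [shift 1 (shift k f)] and [shift k.+1 f] agree only pointwise. *)
Lemma eq_Psi (lam lam' : nat -> nat) (f f' : nat -> 'End(V)) m :
  lam =1 lam' -> f =1 f' -> Psi q lam f m = Psi q lam' f' m.
Proof.
elim: m lam lam' f f' => // -[|m] IH lam lam' f f' eql eqf.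
  by rewrite !Psi1 /dnum !eql eqf.
rewrite !PsiSS /dnum /cnum !eql eqf.
by rewrite (IH _ (shift 1 lam') _ (shift 1 f')) // => i; rewrite /shift.
Qed.

(** [Psi] is a noncommutative polynomial in the [f j]. *)
Lemma Psi_comm (X : 'End(V)) (lam : nat -> nat) (f : nat -> 'End(V)) m :
  (forall j x, X (f j x) = f j (X x)) ->
  forall x, X (Psi q lam f m x) = Psi q lam f m (X x).
Proof.
elim: m lam f => [|[|m] IH] lam f Xf x; first by rewrite !id_lfunE.
  by rewrite Psi1 !scale_lfunE linearZ /= Xf.
have XP := IH (shift 1 lam) (shift 1 f) (fun j => Xf _).
rewrite PsiSS !(scale_lfunE, add_lfunE, opp_lfunE, comp_lfunE).
by rewrite linearZ /= lfun_lincomb Xf !XP Xf.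
Qed.

End PsiGeneral.

(** * Action of E_i on [Psi] applied to weight vectors *)

Section ModuleAction.
Variables (K : fieldType) (q : K) (q0 : q != 0) (r : nat) (M : Uq_module q r).
Implicit Types (x y : M) (mu : nat -> int).
Local Notation Fn := (actFn M).

Lemma actE_actFn (i : 'I_r) (k : nat) x :
  actE M i (Fn k x) = Fn k (actE M i x) +
    (i == k :> nat)%:R *: ((q - q^-1)^-1 *:
      (Kt (actK M) (actKinv M) i x - Ktinv (actK M) (actKinv M) i x)).
Proof.
rewrite /actFn; case: insubP => [j _ <- | k_ge]; first exact: EFc.
rewrite !zero_lfunE linear0 add0r; case: eqP => [ik|]; last by rewrite scale0r.
by rewrite -ik ltn_ord in k_ge.
Qed.

Lemma actE_actFn_comm (i : 'I_r) (k : nat) x :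
  i != k :> nat -> actE M i (Fn k x) = Fn k (actE M i x).
Proof. by move=> /negPf ik; rewrite actE_actFn ik scale0r addr0. Qed.

Lemma actK_actFn (a : 'I_r.+1) (k : nat) x :
  actK M a (Fn k x) =
    q ^ ((a == k.+1 :> nat)%:Z - (a == k :> nat)%:Z) *: Fn k (actK M a x).
Proof.
rewrite /actFn; case: insubP => [j _ <- | _].
  by rewrite KF /rootc opprB -!val_eqE /= /bump /= add1n.
by rewrite !zero_lfunE linear0 scaler0.
Qed.

Lemma actFn_distant (j k : nat) x :
  distant j k -> Fn j (Fn k x) = Fn k (Fn j x).
Proof.
rewrite /actFn => jk; case: insubP => [j' _ ej | _]; last first.
  by rewrite !zero_lfunE linear0.
case: insubP => [k' _ ek | _]; last by rewrite !zero_lfunE linear0.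
by apply: (far_fun _ (rel_serreF (Uq_moduleP M))); rewrite ej ek.
Qed.

(** Weights are indexed by [nat] so that shifted indices need no bound; [y] may be 0, as F_k can
    kill a vector. *)
Definition has_weight mu y := forall a : 'I_r.+1, actK M a y = q ^ mu a *: y.

Lemma has_weight_lin mu c d x y :
  has_weight mu x -> has_weight mu y -> has_weight mu (c *: x - d *: y).
Proof.
move=> hx hy a; rewrite lfun_lincomb hx hy scalerBr !scalerA.
by rewrite [c * _]mulrC [d * _]mulrC.
Qed.

(** For k <= l, the weight change under F_k, ..., F_{l-1} applied once each. *)
Definition lower (k l : nat) mu : nat -> int :=
  fun a => mu a - (a == k)%:Z + (a == l)%:Z.

Lemma has_weight_actFn k mu y :
  has_weight mu y -> has_weight (lower k k.+1 mu) (Fn k y).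
Proof.
move=> hy a; rewrite actK_actFn hy linearZ scalerA -expfzDr //.
by congr (q ^ _ *: _); rewrite /lower; lia.
Qed.

Lemma actKinv_weight mu y (a : 'I_r.+1) :
  has_weight mu y -> actKinv M a y = q ^ (- mu a) *: y.
Proof.
move=> hy; have := congr1 (actKinv M a) (hy a).
rewrite linearZ /= -comp_lfunE (rel_KmK (Uq_moduleP M)) id_lfunE => {2}->.
by rewrite scalerA -expfzDr // addNr scale1r.
Qed.

(** [Kt] at i acts on [y] by q^(mu_i - mu_{i+1}), which turns [E_i, F_i] into a quantum integer. *)
Lemma actE_actFn_weight (i : 'I_r) (k : nat) mu y : has_weight mu y ->
  actE M i (Fn k y) =
    Fn k (actE M i y) + (i == k :> nat)%:R *: (qint q (mu k - mu k.+1) *: y).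
Proof.
move=> hy; rewrite actE_actFn; case: eqP => [<-|]; last by rewrite !scale0r.
rewrite !comp_lfunE !(actKinv_weight _ hy) ![actK M _ (_ *: _)]linearZ /=.
rewrite !hy !scalerA.
rewrite !mul1r -scalerBl scalerA /qint -!expfzDr // opprB mulrC.
by rewrite /= /bump /= add1n [- mu _ + _]addrC [- mu i + _]addrC.
Qed.

Variable lam : nat -> nat.

(* [P k m] is [Psi_m^{+(k)}]; it only involves F_k, ..., F_{k+m-1}. *)
Local Notation P k m := (Psi q (shift k lam) (shift k Fn) m).

Lemma Psi_shiftSS k m : P k m.+2 =
  (qint q (dnum (shift k lam) m.+2))^-1 *:
    (qint q (cnum (shift k lam) m.+2) *: (Fn k \o P k.+1 m.+1)
     - qint q (cnum (shift k lam) m.+2 - 1) *: (P k.+1 m.+1 \o Fn k))%VF.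
Proof.
rewrite PsiSS -[shift k Fn 0]/(Fn (k + 0)) addn0.
rewrite (@eq_Psi _ _ _ _ (shift k.+1 lam) _ (shift k.+1 Fn)) //.
  by move=> i; rewrite /shift add1n addnS.
by move=> i; rewrite /shift add1n addnS.
Qed.

Lemma has_weight_Psi k m mu y :
  has_weight mu y -> has_weight (lower k (k + m) mu) (P k m y).
Proof.
elim: m k mu y => [|[|m] IH] k mu y hy.
- move=> a; rewrite id_lfunE hy; congr (q ^ _ *: _).
  by rewrite /lower addn0; lia.
- move=> a; rewrite Psi1 scale_lfunE linearZ /= /shift addn0 addn1.
  by rewrite (has_weight_actFn _ hy) !scalerA mulrC.
have eqw mu1 mu2 z : mu1 =1 mu2 -> has_weight mu1 z -> has_weight mu2 z.
  by move=> e h a; rewrite h e.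
rewrite Psi_shiftSS scale_lfunE !(add_lfunE, opp_lfunE, scale_lfunE).
rewrite scalerBr !scalerA !comp_lfunE.
apply: has_weight_lin.
  apply: eqw (has_weight_actFn _ (IH k.+1 mu y hy)) => a; rewrite /lower; lia.
by apply: eqw (IH k.+1 _ _ (has_weight_actFn _ hy)) => a; rewrite /lower; lia.
Qed.

(** Only F_j with j >= k > i occur here, and E_i commutes with them. *)
Lemma actE_Psi_lt (i : 'I_r) k m y :
  (i < k)%N -> actE M i y = 0 -> actE M i (P k m y) = 0.
Proof.
move=> ik Ey; rewrite Psi_comm ?Ey ?linear0 // => j x.
by rewrite actE_actFn_comm // ltn_eqF // ltn_addr.
Qed.

Hypothesis qru : not_root_of_unity q.

(* The weight [mu] of [y] may differ from [lam] at [k]: the second summand of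
   [Psi] applies [P k.+1 m] to [Fn k y], of weight [lam k.+1 + 1] at [k.+1]. *)
Lemma actE_Psi k m mu y (i : 'I_r) :
  has_weight mu y ->
  (forall j, (k < j <= k + m.+1)%N -> mu j = lam j) ->
  (forall j, (k <= j <= k + m)%N -> (lam (k + m.+1) < lam j)%N) ->
  (forall j : 'I_r, (k <= j)%N -> actE M j y = 0) ->
  (k <= i)%N ->
  actE M i (P k m.+1 y) = (i == k :> nat)%:R *:
    (qint q (mu k - (lam (k + m.+1)%N)%:Z + m%:Z)
       / qint q (dnum (shift k lam) m.+1) *: P k.+1 m y).
Proof.
elim: m k mu y i => [|m IH] k mu y i hy mu_lam lam_gt Ey ki.
  rewrite Psi1 scale_lfunE linearZ /= /shift addn0 (actE_actFn_weight _ _ hy).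
  rewrite Ey // linear0 add0r id_lfunE (mu_lam k.+1); last by lia.
  by rewrite addr0 addn1 !scalerA mulrA; congr (_ *: _); ring.
rewrite Psi_shiftSS scale_lfunE !(add_lfunE, opp_lfunE, scale_lfunE).
rewrite !comp_lfunE linearZ /= lfun_lincomb.
set c := cnum _ _; set d := dnum _ _.
have [ik|] := eqVneq (i : nat) k.
  have EPy : actE M i (P k.+1 m.+1 y) = 0.
    by apply: actE_Psi_lt; rewrite ?Ey ?ik.
  rewrite (actE_actFn_weight _ _ (has_weight_Psi _ _ hy)) EPy linear0 add0r.
  rewrite Psi_comm; last first.
    by move=> j x; rewrite actE_actFn_comm // ltn_eqF // ik ltn_addr.
  rewrite (actE_actFn_weight _ _ hy) Ey // linear0 add0r ik eqxx !scale1r.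
  rewrite [Psi _ _ _ _ (_ *: _)]linearZ /= !scalerA -scalerBl scalerA mulrC.
  congr (_ / _ *: _).
  (* [P k.+1 m.+1] lowers coordinate [k.+1] by one, hence the + 1: the two orders of the product
     give [a + 1] and [a]. *)
  have -> : lower k.+1 (k.+1 + m.+1) mu k - lower k.+1 (k.+1 + m.+1) mu k.+1
      = (mu k - mu k.+1) + 1 by rewrite /lower; lia.
  rewrite qint_bilinear //; congr qint.
  rewrite (mu_lam k.+1); last by lia.
  by rewrite /c /cnum /shift addn1; lia.
(* Now E_i commutes with F_k, and the induction hypothesis applies to both [y] and [Fn k y]. *)
move=> ik; have ki1 : (k < i)%N by lia.
rewrite actE_actFn_comm // scale0r.
have mu_lam' : forall j, (k.+1 < j <= k.+1 + m.+1)%N -> mu j = lam j.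
  by move=> j j_int; apply: mu_lam; lia.
have lam_gt' : forall j, (k.+1 <= j <= k.+1 + m)%N ->
    (lam (k.+1 + m.+1) < lam j)%N.
  by move=> j j_int; rewrite addSnnS; apply: lam_gt; lia.
rewrite (IH _ _ _ _ hy) //; last by move=> j kj; apply: Ey; lia.
rewrite (IH _ _ _ _ (has_weight_actFn k hy)) //; first last.
- by move=> j kj; rewrite actE_actFn_comm ?Ey ?linear0 //; lia.
- by move=> j j_int; rewrite -mu_lam' // /lower; lia.
have [_|_] := eqVneq (i : nat) k.+1; last first.
  by rewrite !scale0r linear0 !scaler0 subrr scaler0.
rewrite !scale1r linearZ /=.
have -> : P k.+2 m (Fn k y) = Fn k (P k.+2 m y).
  rewrite Psi_comm // => j x; apply: actFn_distant.
  by rewrite /distant; lia.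
set d1 := dnum (shift k.+1 lam) m.+1.
have cE : c = d1 + 1.
  by rewrite /c /d1 /cnum /dnum /shift addn0 addn1 addSnnS; lia.
(* The strict inequality from [lam_gt'] makes [d1] positive. *)
have d1_neq0 : qint q d1 != 0.
  have := lam_gt' k.+1; rewrite leqnn leq_addr => /(_ isT) lt.
  by apply: qint_neq0 => //; rewrite /d1 /dnum /shift addn0; lia.
have -> : mu k.+1 - (lam (k.+1 + m.+1)%N)%:Z + m%:Z = d1.
  by rewrite (mu_lam k.+1) /d1 /dnum /shift ?addn0; lia.
have -> : lower k k.+1 mu k.+1 - (lam (k.+1 + m.+1)%N)%:Z + m%:Z = c.
  by rewrite cE /lower (mu_lam k.+1) /d1 /dnum /shift ?addn0; lia.
(* The terms have coefficients [c] and [c - 1][c]/[d1], equal since c - 1 = d1. *)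
rewrite divff // scale1r scalerA cE addrK mulrCA divff // mulr1.
by rewrite subrr scaler0.
Qed.

End ModuleAction.

(** * Maximality of [Phi] applied to a maximal vector *)

Section PhiMaximal.
Variables (K : fieldType) (q : K) (q0 : q != 0) (qru : not_root_of_unity q).
Variables (r : nat) (M : Uq_module q r) (lam : nat -> nat) (b : M).
Implicit Types (i : 'I_r) (m a : 'I_r.+1) (x : M).
Local Notation P k j := (Psi q (shift k lam) (shift k (actFn M)) j).
Local Notation vt := (@vtens K q r q0 qru M).

Lemma Phi_sum m : Phi q0 qru lam b m =
  \sum_(j < m.+1) (- q^-1) ^+ j *: vt (inord (m - j)) (P (m - j) j b).
Proof.
rewrite /Phi; case: eqP => // ->.
rewrite big_ord_recl big_ord0 addr0 expr0 scale1r subnn id_lfunE.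
by rewrite (_ : inord _ = ord0) //; apply/val_inj; rewrite /= inordK.
Qed.

Lemma actE_vtens i a x : actE (Vq_tensor q0 qru M) i (vt a x) =
  (a == i.+1 :> nat)%:R *: vt (lo i) x +
  q ^ ((a == i :> nat)%:Z - (a == i.+1 :> nat)%:Z) *: vt a (actE M i x).
Proof.
rewrite [LHS]tensorEE /= vecEE tensZl comp_lfunE vecKinvE linearZ /= vecKE.
rewrite scalerA -expfzDr // tensZl addrC.
by rewrite -!val_eqE /= /bump add1n [- _ + _]addrC [LHS]addrC.
Qed.

Lemma actK_vtens (c : 'I_r.+1) a x : actK (Vq_tensor q0 qru M) c (vt a x) =
  q ^ (a == c)%:Z *: vt a (actK M c x).
Proof. by rewrite [LHS]tensorKE /= vecKE tensZl. Qed.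

(** The map sending u (x) x to u_m x takes [Phi] to [b], since only the term j = 0 involves v_m. *)
Lemma Phi_neq0 m : b != 0 -> Phi q0 qru lam b m != 0.
Proof.
move=> b0; pose B (u : 'rV[K]_r.+1) x := u 0 m *: x.
have [f [fE _]] : exists! f : 'Hom(Vq_tensor q0 qru M, M),
    forall u x, f (tens u x) = B u x.
  by apply: tens_univ => [x c u u' | u c x x']; rewrite /B;
    [rewrite !mxE scalerDl scalerA | rewrite scalerDr !scalerA mulrC].
have fv a x : f (vt a x) = (a == m)%:R *: x.
  by rewrite fE /B mxE eqxx /= eq_sym.
apply: contraNneq b0 => /(congr1 f); rewrite linear0 Phi_sum linear_sum /=.
rewrite big_ord_recl big1 => [|j _].
  rewrite addr0 expr0 scale1r subn0 id_lfunE fv.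
  by rewrite -val_eqE /= inordK ?ltn_ord // eqxx scale1r => ->.
rewrite linearZ /= fv -val_eqE /= inordK; last first.
  by apply: leq_ltn_trans (ltn_ord m); apply: leq_subr.
rewrite [_ == _]ltn_eqF ?scale0r ?scaler0 //.
(* An index [j] exists here only if m > 0. *)
by rewrite ltn_subrL /bump /=; case: (nat_of_ord m) j => [[]|].
Qed.

Variable mu : 'rV[int]_r.+1.
Hypotheses (mu_lam : forall a, mu 0 a = lam a) (b_max : maximal_vector mu b).

Lemma maximal_has_weight : has_weight (fun j : nat => (lam j)%:Z) b.
Proof. by case: b_max => _ /wt_spaceP bw _ a; rewrite bw mu_lam. Qed.

(** In each term v_{m-j} adds e_{m-j} to the weight, and [Psi] trades e_{m-j} for e_m. *)
Lemma Phi_weight m : Phi q0 qru lam b m \in wt_space _ (mu + delta_mx 0 m).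
Proof.
rewrite Phi_sum; apply: memv_suml => j _; apply: memvZ; apply/wt_spaceP => a.
rewrite actK_vtens (has_weight_Psi q0 lam _ _ maximal_has_weight).
rewrite /vtens tensZr scalerA.
rewrite -expfzDr //; congr (q ^ _ *: _); rewrite !mxE mu_lam /lower.
have jm : (j <= m)%N by rewrite -ltnS.
rewrite -!val_eqE /= inordK; last by have := ltn_ord m; lia.
by rewrite subnK // eq_sym; lia.
Qed.

(** Without excess weight the factor in [actE_Psi] is [d]/[d] with d > 0. *)
Lemma actE_Psi_maximal i k l :
  (forall j, (k <= j <= k + l)%N -> (lam (k + l.+1) < lam j)%N) ->
  actE M i (P k l.+1 b) = (i == k :> nat)%:R *: P k.+1 l b.
Proof.
case: b_max => _ _ Eb lam_gt; case: (leqP k i) => ki; last first.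
  by rewrite (actE_Psi_lt lam) ?Eb // ltn_eqF // scale0r.
rewrite (actE_Psi q0 qru maximal_has_weight) //; congr (_ *: _).
rewrite [X in X / _ *: _](_ : _ = qint q (dnum (shift k lam) l.+1)).
  rewrite divff ?scale1r // qint_neq0 // /dnum /shift addn0.
  by have := lam_gt k; rewrite leqnn leq_addr => /(_ isT); lia.
by congr qint; rewrite /dnum /shift addn0; lia.
Qed.

(* The terms of [E_i (Phi m)] telescope: [E_i] sends the terms of [Phi] at
   [v_{i+1}] and [v_i] to opposite multiples of [v_i], and all others to 0. *)
Lemma actE_Phi i m : (forall j, (j < m)%N -> (lam m < lam j)%N) ->
  actE (Vq_tensor q0 qru M) i (Phi q0 qru lam b m) = 0.
Proof.
move=> lam_gt; have [_ _ Eb] := b_max.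
pose C := (- q^-1) ^+ (m - i.+1) *: vt (lo i) (P i.+1 (m - i.+1) b).
(* Term j contributes [h j.+1] through E_i on v_{m-j} and [- h j] through E_i on [Psi]; the guard
   reflects that E_i kills [b] itself. *)
pose h j := ((0 < j)%N && (j + i == m)%N)%:R *: C.
rewrite Phi_sum linear_sum /=.
transitivity (\sum_(0 <= j < m.+1) (h j.+1 - h j)); last first.
  rewrite telescope_sumr // /h /= scale0r subr0.
  by rewrite gtn_eqF ?scale0r // addSn ltnS leq_addr.
rewrite big_mkord; apply: eq_bigr => -[j /=]; rewrite ltnS => jm _.
rewrite linearZ /= actE_vtens inordK; last by have := ltn_ord m; lia.
rewrite scalerDr; congr (_ + _).
  rewrite /h /= (_ : (m - j == i.+1)%N = (j.+1 + i == m)%N); last by lia.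
  case: eqP => [e|_]; last by rewrite !scale0r scaler0.
  by rewrite !scale1r /C -e addSnnS addnK subDnCA // subnn addn0.
case: j jm => [|j] jm.
  by rewrite id_lfunE Eb [vt _ 0]tens0r !scaler0 /h /= scale0r oppr0.
rewrite actE_Psi_maximal; last first.
  by move=> l lj; rewrite subnK //; apply: lam_gt; lia.
rewrite /h /= (_ : (i == (m - j.+1)%N :> nat) = (j.+1 + i == m)%N); last by lia.
have [e|_] := eqVneq (j.+1 + i)%N m; last first.
  by rewrite !scale0r [vt _ 0]tens0r !scaler0 oppr0.
have -> : (m - j.+1)%N = i by lia.
(* [Kt] scales v_i by q, turning (-1/q)^(j+1) into -(-1/q)^j. *)
rewrite eqxx [_ == _]ltn_eqF // subr0 expr1z !scale1r /C.
have -> : (m - i.+1)%N = j by lia.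
rewrite scalerA exprSr -mulrA mulNr mulVf // mulrN1 scaleNr.
rewrite (_ : inord i = lo i) //.
by apply/val_inj; rewrite /= inordK // ltnS ltnW.
Qed.

(** The inequality is vacuous for m = 0, so both halves of the theorem follow from this. *)
Lemma Phi_maximal m : (forall j, (j < m)%N -> (lam m < lam j)%N) ->
  maximal_vector (mu + delta_mx 0 m) (Phi q0 qru lam b m).
Proof.
move=> lam_gt; split; last by move=> i; apply: actE_Phi.
  by apply: Phi_neq0; case: b_max.
exact: Phi_weight.
Qed.

End PhiMaximal.

Theorem theorem6p4 (K : fieldType) (q : K) (q0 : q != 0)
    (qru : not_root_of_unity q) (r : nat) (M : Uq_module q r)
    (Mwt : weight_module M) (lam : seq nat) (lam_part : sorted geq lam)
    (lam_size : (size lam <= r.+1)%N) (b : M)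
    (b_max : maximal_vector (part_weight r lam) b) :
  (Phi q0 qru (part lam) b ord0 = vtens q0 qru ord0 b /\
   maximal_vector (part_weight r lam + delta_mx 0 ord0)
     (Phi q0 qru (part lam) b ord0)) /\
  (forall m : 'I_r.+1, (0 < m)%N -> part lam m.-1 != part lam m ->
     maximal_vector (part_weight r lam + delta_mx 0 m)
       (Phi q0 qru (part lam) b m)).
Proof.
have lamE (a : 'I_r.+1) : part_weight r lam 0 a = part lam a by rewrite mxE.
have part_le j k : (j <= k)%N -> (part lam k <= part lam j)%N.
  move=> jk; case: (ltnP k (size lam)) => [k_lt|k_ge]; last first.
    by rewrite /part nth_default.
  apply: (sorted_leq_nth (leT := geq)) => //.
  - by move=> y x z yx zy; apply: leq_trans zy yx.
  - exact: leqnn.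
  - exact: leq_ltn_trans jk k_lt.
split; first by split; [|apply: Phi_maximal].
move=> m m_gt0 neq; apply: Phi_maximal => // j jm.
(* By monotonicity, the single strict drop from m - 1 to m puts [part lam m] below all earlier
   parts. *)
apply: (@leq_trans (part lam m.-1)).
  by rewrite ltn_neqAle eq_sym neq part_le // leq_pred.
by apply: part_le; rewrite -ltnS prednK.
Qed.
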